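(* For each positive integer $n\ge 3$, there exists a self-dual regular $3$-polytope $\mathcal{P}$ of Schläfli type $\{n,n\}$ with $2^n n$ flags.
   Context: An abstract polytope of rank $d$ (a $d$-polytope) is a partially ordered set $\mathcal{P}$ with a strictly order-preserving rank function $\mathrm{rank}:\mathcal{P}\to\{-1,0,\ldots,d\}$ such that: (i) $\mathcal{P}$ has a unique minimal element $F_{-1}$ (of rank $-1$) and a unique maximal element $F_d$ (of rank $d$); (ii) every maximal totally ordered subset (called a flag) contains exactly $d+2$ elements, including $F_{-1}$ and $F_d$; (iii) (diamond condition) whenever $F<G$ in $\mathcal{P}$ with $\mathrm{rank}(G)-\mathrm{rank}(F)=2$, there are exactly two elements $H$ with $F<H<G$; (iv) (strong connectivity) any two flags $\Phi,\Psi$ can be joined by a sequence of flags $\Phi=\Phi_0,\Phi_1,\ldots,\Phi_k=\Psi$ such that consecutive flags differ in exactly one element and every $\Phi_i$ contains $\Phi\cap\Psi$. An element of rank $i$ is called an $i$-face. An automorphism of $\mathcal{P}$ is an order-preserving bijection $\mathcal{P}\to\mathcal{P}$ that preserves the partial order structure (its inverse is also order-preserving) and the ranks; the group of automorphisms is $\mathrm{Aut}(\mathcal{P})$. The polytope $\mathcal{P}$ is regular if $\mathrm{Aut}(\mathcal{P})$ acts transitively on flags (equivalently, for finite $\mathcal{P}$, $|\mathrm{Aut}(\mathcal{P})|$ equals the number of flags). For a regular $d$-polytope with a fixed base flag $\Phi$, let $\rho_i\in\mathrm{Aut}(\mathcal{P})$ ($0\le i\le d-1$) be the automorphism mapping $\Phi$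 to the unique flag differing from $\Phi$ exactly in the $i$-face; the (Schläfli) type of $\mathcal{P}$ is $\{p_1,\ldots,p_{d-1}\}$, where $p_i$ is the order of $\rho_{i-1}\rho_i$. The dual $\mathcal{P}^*$ is obtained from $\mathcal{P}$ by reversing the partial order, and $\mathcal{P}$ is self-dual if $\mathcal{P}\cong\mathcal{P}^*$. *)

(* Defs.v *)
From HB Require Import structures.
From mathcomp Require Import all_boot all_order all_algebra all_fingroup.
Set Implicit Arguments.
Unset Strict Implicit.
Unset Printing Implicit Defensive.

Import Order.TTheory GRing.Theory Num.Theory.

(* Polytopes are taken on finite posets.  This loses nothing for polytopes with
   finitely many flags, because every face lies in a flag and flags are finite.
   Ranks are integers, the least face having rank -1. *)

Section Flags.
Variables (disp : Order.disp_t) (T : finPOrderType disp).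
Implicit Types A B : {set T}.

Definition is_chain A : bool :=
  [forall x in A, forall y in A, (x >=< y)%O].

Definition flags : {set {set T}} := [set A | maxset is_chain A].

Definition is_minimal (x : T) : Prop := forall y : T, (y <= x)%O -> y = x.
Definition is_maximal (x : T) : Prop := forall y : T, (x <= y)%O -> y = x.

(* A and B differ in exactly one element: B is A with one element replaced. *)
Definition adjacent A B : bool := (#|A :\: B| == 1) && (#|B :\: A| == 1).

Definition joined_by (A : {set T}) (s : seq {set T}) (B : {set T}) : Prop :=
  [/\ path adjacent A s, last A s = B &
      {in A :: s, forall C, C \in flags /\ A :&: B \subset C}].

End Flags.

Arguments flags {disp} T.

Section Polytope.
Local Open Scope ring_scope.
Variables (disp : Order.disp_t) (T : finPOrderType disp) (rk : T -> int).

Record is_polytope (d : nat) : Prop := IsPolytope {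
  rank_bounds : forall x : T, -1 <= rk x <= d%:Z;
  rank_strict : forall x y : T, (x < y)%O -> rk x < rk y;
  least_greatest : exists Fmin Fmax : T,
    [/\ forall x, is_minimal x <-> x = Fmin,
        forall x, is_maximal x <-> x = Fmax,
        rk Fmin = -1,
        rk Fmax = d%:Z &
        forall A, A \in flags T -> [/\ #|A| = d.+2, Fmin \in A & Fmax \in A]];
  diamond : forall F G : T, (F < G)%O -> rk G - rk F = 2 ->
    #|[set H : T | (F < H < G)%O]| = 2%N;
  strongly_connected : {in flags T &, forall A B, exists s, joined_by A s B}
}.

Definition polytope_aut : {set {perm T}} :=
  [set g : {perm T} |
    [forall x, forall y, (g x <= g y)%O == (x <= y)%O] &&
    [forall x, rk (g x) == rk x]].

Lemma polytope_aut_group_set : group_set polytope_aut.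
Proof.
apply/group_setP; split=> [|g h]; rewrite !inE.
  by apply/andP; split; [apply/forallP=> x; apply/forallP=> y|apply/forallP=> x];
     rewrite !perm1.
move=> /andP[/forallP gle /forallP grk] /andP[/forallP hle /forallP hrk].
apply/andP; split; apply/forallP=> x; last first.
  by rewrite permM (eqP (hrk _)).
apply/forallP=> y; rewrite !permM.
by rewrite (eqP (forallP (hle _) _)) (eqP (forallP (gle _) _)).
Qed.
Canonical polytope_aut_group := Group polytope_aut_group_set.

Definition is_regular : Prop := [transitive polytope_aut, on flags T | 'P^*].

Definition i_adjacent (i : nat) (A B : {set T}) : Prop :=
  adjacent A B /\ {in (A :\: B) :|: (B :\: A), forall x, rk x = i%:Z}.

Definition distinguished_generators (d : nat) (A : {set T})
    (rho : nat -> {perm T}) : Prop :=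
  forall i : nat, (i < d)%N ->
    rho i \in polytope_aut /\ i_adjacent i A (rho i @: A).

(* For a regular polytope the choice of base flag A is immaterial, and rho is
   determined by A on indices below d.  The entry p_i is nth 0 p i.-1. *)
Definition has_schlafli_type (d : nat) (p : seq nat) : Prop :=
  exists (A : {set T}) (rho : nat -> {perm T}),
    [/\ A \in flags T, distinguished_generators d A rho, size p = d.-1 &
        forall i : nat, (0 < i < d)%N ->
          nth 0%N p i.-1 = #[rho i.-1 * rho i]%g].

End Polytope.

Definition isomorphic (disp1 disp2 : Order.disp_t)
    (T1 : finPOrderType disp1) (T2 : finPOrderType disp2)
    (rk1 : T1 -> int) (rk2 : T2 -> int) : Prop :=
  exists f : T1 -> T2,
    [/\ bijective f, {mono f : x y / (x <= y)%O} & forall x, rk2 (f x) = rk1 x].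

(* Reversing the order sends rank -1 to rank d and conversely. *)
Definition dual_rank (disp : Order.disp_t) (T : finPOrderType disp) (d : nat)
    (rk : T -> int) : T^d -> int := fun x => (d%:Z - 1 - rk x)%R.

Definition self_dual (disp : Order.disp_t) (T : finPOrderType disp) (d : nat)
    (rk : T -> int) : Prop := isomorphic rk (dual_rank d rk).

(* Main.v *)
Require Import Defs.
From mathcomp Require Import all_boot all_order all_algebra all_fingroup.
From mathcomp Require Import cyclic.
From HB Require Import structures.
Set Implicit Arguments.
Unset Strict Implicit.
Unset Printing Implicit Defensive.

Import Order.TTheory GRing.Theory Num.Theory.

(** The squares of the n-cube that are spanned by two cyclically consecutive
    directions are the faces of a regular map of type {4, n} on the cube graph,
    and the polytope is obtained from this map by halving.  Let V be the space of
    binary vectors with coordinates indexed by the integers modulo n.  The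
    vertices of the polytope are the even vectors, its 2-faces are the odd
    vectors, and its edges are the squares x + <e_i, e_(i+1)>.  A vector is
    incident with the squares that contain it, and an even vector is incident
    with an odd one when some square contains both, that is, when they are
    neighbours in the cube.

    Such a poset is determined by a colouring of points and a set of blocks, and
    it is studied at that level of generality first.  The diamond condition says
    that a block has two points of either colour and that two points of different
    colours in a common block have exactly two common blocks; both are visible
    for squares ([square_half], [square_link]).  Strong connectivity reduces to
    connecting the flags through a given point, and all flags: the squares at x
    are arranged in a cycle ([connect_around]), and the cube graph is connected
    ([connect_all]).

    A permutation of the points that maps blocks to blocks induces an
    automorphism when it preserves the colours, and an isomorphism with the dual
    when it exchanges them.  A flag consists of a cube edge {x, x + e_i} and of
    one of the two squares at that edge, in directions i and i + s with
    s = 1 or -1.  The affine map that permutes the coordinates by j |-> i + s j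
    and then adds x takes the base flag (0, 0, 1) to (x, i, s).  The maps with
    x even prove regularity, and any map with x odd proves self-duality.  Pairs
    (x, i) index the flags bijectively once s is prescribed by the parity of x,
    so there are 2^n n flags.

    The distinguished generators are explicit maps of this kind.  The product of
    the last two is the cyclic shift of coordinates, of order n.  Conjugation by
    the translation by e_0, a duality that maps the base flag to itself, exchanges
    the first generator with the last and fixes the middle one, so the product of
    the first two also has order n. *)

(** * Flags of graded posets *)

Section GradedPoset.
Variables (disp : Order.disp_t) (T : finPOrderType disp).
Variables (d : nat) (lvl : T -> nat) (bot top : T).
Hypotheses (lvl_bot : lvl bot = 0) (lvl_top : lvl top = d.+1).
Hypotheses (le_bot : forall x, (bot <= x)%O) (le_top : forall x, (x <= top)%O).
Hypothesis lvl_lt : forall x y, (x < y)%O -> lvl x < lvl y.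
Hypothesis lvl_between : forall x y r, (x < y)%O -> lvl x < r < lvl y ->
  exists2 z, (x < z < y)%O & lvl z = r.

Lemma chainP (A : {set T}) : reflect {in A &, forall x y, (x >=< y)%O} (is_chain A).
Proof.
apply: (iffP forall_inP) => [H x y xA yA | H x xA]; first exact: (forall_inP (H x xA)).
by apply/forall_inP => y yA; apply: H.
Qed.

Lemma aut_chain (g : {perm T}) (A : {set T}) :
  {mono g : x y / (x <= y)%O} -> is_chain A -> is_chain (g @: A).
Proof.
move=> gM /chainP Ach; apply/chainP => _ _ /imsetP[x xA ->] /imsetP[y yA ->].
by rewrite /Order.comparable !gM; apply: Ach.
Qed.

Lemma aut_flag (g : {perm T}) (A : {set T}) :
  {mono g : x y / (x <= y)%O} -> A \in flags T -> g @: A \in flags T.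
Proof.
move=> gM; rewrite !inE => /maxsetP[Ach Amax]; apply/maxsetP; split; first exact: aut_chain.
have gVM : {mono (g^-1)%g : x y / (x <= y)%O} by move=> x y; rewrite -gM !permKV.
move=> B Bch AB; rewrite -(Amax _ (aut_chain gVM Bch)).
  by rewrite -imset_comp (eq_imset _ (permKV g)) imset_id.
by rewrite -(imset_id A) -(eq_imset _ (permK g)) (imset_comp (g^-1)%g g) imsetS.
Qed.

Lemma flag_absorbs (A : {set T}) z :
  A \in flags T -> {in A, forall x, (x >=< z)%O} -> z \in A.
Proof.
rewrite inE => /maxsetP[/chainP Ach Amax] zA.
rewrite -(Amax (z |: A)) ?subsetUr ?setU11 //.
apply/chainP => x y /setU1P[->|xA] /setU1P[->|yA].
- exact: comparablexx.
- by rewrite comparable_sym zA.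
- exact: zA.
- exact: Ach.
Qed.

Lemma chain_lvl_le (A : {set T}) :
  is_chain A -> {in A &, forall x y, lvl x <= lvl y -> (x <= y)%O}.
Proof.
move=> /chainP Ach x y xA yA; have := Ach x y xA yA.
by case: comparableP => // /lvl_lt; rewrite ltnNge => /negP.
Qed.

Lemma chain_lvl_inj (A : {set T}) : is_chain A -> {in A &, injective lvl}.
Proof.
move=> Ach x y xA yA exy; apply/le_anti.
by rewrite !(chain_lvl_le Ach) // exy.
Qed.

Lemma bot_in_flag (A : {set T}) : A \in flags T -> bot \in A.
Proof. by move/flag_absorbs; apply=> x _; rewrite ge_comparable. Qed.

Lemma top_in_flag (A : {set T}) : A \in flags T -> top \in A.
Proof. by move/flag_absorbs; apply=> x _; rewrite le_comparable. Qed.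

(** If a level r were missing from a flag, its highest face below r and its lowest
    face above r would be comparable to any face of level r between them, and
    such a face could be added. *)
Lemma flag_lvl_surj (A : {set T}) r :
  A \in flags T -> r <= d.+1 -> exists2 x, x \in A & lvl x = r.
Proof.
move=> Afl le_r; have [/exists_inP[x xA /eqP]|/exists_inPn noA] :=
  boolP [exists x in A, lvl x == r]; first by exists x.
have ch : is_chain A by move: Afl; rewrite inE => /maxsetP[].
have {}noA x : x \in A -> (lvl x < r) || (r < lvl x).
  by move=> /noA; rewrite neq_ltn.
have bA := bot_in_flag Afl; have tA := top_in_flag Afl.
have b_r : (bot \in A) && (lvl bot < r).
  by rewrite bA; have := noA _ bA; rewrite lvl_bot ltn0 orbF.
have r_t : (top \in A) && (r < lvl top).
  by rewrite tA; have := noA _ tA; rewrite lvl_top ltnNge le_r.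
pose lo := [arg max_(x > bot | (x \in A) && (lvl x < r)) lvl x].
pose hi := [arg min_(x < top | (x \in A) && (r < lvl x)) lvl x].
have [/andP[loA lo_r] lo_max] : ((lo \in A) && (lvl lo < r)) /\
    (forall x, (x \in A) && (lvl x < r) -> lvl x <= lvl lo).
  by rewrite /lo; case: arg_maxnP.
have [/andP[hiA r_hi] hi_min] : ((hi \in A) && (r < lvl hi)) /\
    (forall x, (x \in A) && (r < lvl x) -> lvl hi <= lvl x).
  by rewrite /hi; case: arg_minnP.
have lohi : (lo < hi)%O.
  have lvl_lohi := ltn_trans lo_r r_hi.
  rewrite lt_neqAle (chain_lvl_le ch) ?(ltnW lvl_lohi) // andbT.
  by apply: contraTneq lvl_lohi => ->; rewrite ltnn.
have [|z /andP[loz zhi] zr] := @lvl_between lo hi r lohi; first by rewrite lo_r r_hi.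
have : z \in A.
  apply: flag_absorbs => // x xA; case/orP: (noA _ xA) => ltx.
    apply: le_comparable; apply: le_trans (ltW loz).
    by apply: (chain_lvl_le ch) => //; apply: lo_max; rewrite xA.
  apply: ge_comparable; apply: le_trans (ltW zhi) _.
  by apply: (chain_lvl_le ch) => //; apply: hi_min; rewrite xA.
by move/noA; rewrite zr ltnn.
Qed.

Lemma lvl_bound x : lvl x < d.+2.
Proof.
by have := le_top x; rewrite le_eqVlt => /predU1P[->|/lvl_lt]; rewrite lvl_top // => /leqW.
Qed.

Let lvlI x : 'I_d.+2 := Ordinal (lvl_bound x).

Lemma chain_lvlI_inj (A : {set T}) : is_chain A -> {in A &, injective lvlI}.
Proof. by move=> ch x y xA yA [] /(chain_lvl_inj ch); apply. Qed.

(** The level is a bijection from a flag to {0, ..., d + 1}. *)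
Lemma card_flag (A : {set T}) : A \in flags T -> #|A| = d.+2.
Proof.
move=> Afl; have ch : is_chain A by move: Afl; rewrite inE => /maxsetP[].
rewrite -(card_in_imset (chain_lvlI_inj ch)) -[RHS]card_ord -cardsT; congr #|pred_of_set _|.
apply/setP=> i; rewrite inE; have [x xA xi] := flag_lvl_surj Afl (ltn_ord i).
by apply/imsetP; exists x => //; apply: val_inj.
Qed.

Lemma chain_of_full_card_is_flag (A : {set T}) :
  is_chain A -> #|A| = d.+2 -> A \in flags T.
Proof.
move=> ch cA; rewrite inE; apply/maxsetP; split=> // B chB AB.
apply/esym/eqP; rewrite eqEcard AB cA -(card_in_imset (chain_lvlI_inj chB)).
by rewrite (leq_trans (max_card _)) ?card_ord.
Qed.

End GradedPoset.

(** * The poset of a two-coloured block system *)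

Section BlockPoset.
Variables (V : finType) (p : V -> bool) (E : {set {set V}}).

Definition block := {e : {set V} | e \in E}.
(** The two booleans are the least and the greatest face.  The colouring is a
    phantom argument: the order depends on it. *)
Definition block_poset of (V -> bool) := (bool + (V + block))%type.
Local Notation T := (block_poset p).

HB.instance Definition _ := Finite.on T.

Definition ext (b : bool) : T := inl b.
Definition node (x : V) : T := inr (inl x).
Definition blk (e : block) : T := inr (inr e).

(** The level is the rank plus one. *)
Definition level (x : T) : nat :=
  match x with
  | inl b => if b then 4 else 0
  | inr (inl x) => if p x then 3 else 1
  | inr (inr _) => 2
  end.

(** Incidence forgets the colouring and is symmetric, so that exchanging the two
    colours reverses the order. *)
Definition incident (x y : T) : bool :=
  match x, y with
  | inl _, _ | _, inl _ => true
  | inr (inl u), inr (inl w) => [exists e in E, (u \in e) && (w \in e)]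
  | inr (inl u), inr (inr e) | inr (inr e), inr (inl u) => u \in val e
  | inr (inr e), inr (inr f) => e == f
  end.

Definition block_lt (x y : T) : bool := (level x < level y) && incident x y.

Lemma block_lt_irr : irreflexive block_lt.
Proof. by move=> x; rewrite /block_lt ltnn. Qed.

Lemma block_lt_trans : transitive block_lt.
Proof.
move=> y x z /andP[lxy ixy] /andP[lyz iyz].
rewrite /block_lt (ltn_trans lxy lyz) /=; move: lxy ixy lyz iyz.
case: x => [[]|[x|x]] //=; case: z => [[]|[z|z]] //=; case: y => [[]|[y|y]] //=.
all: try (case: (p x) => //); try (case: (p y) => //); try (case: (p z) => //).
by move=> _ xy _ yz; apply/exists_inP; exists (val y); rewrite ?(valP y) ?xy.
Qed.

Fact block_display : Order.disp_t. Proof. exact: Order.Disp tt tt. Qed.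

HB.instance Definition _ := Order.Lt_isPOrder.Build block_display T
  block_lt_irr block_lt_trans.

Lemma ltE (x y : T) : (x < y)%O = (level x < level y) && incident x y.
Proof. by []. Qed.

Lemma leE (x y : T) : (x <= y)%O = (x == y) || ((level x < level y) && incident x y).
Proof. by []. Qed.

Definition block_rank (x : T) : int := ((level x)%:Z - 1)%R.

Lemma level_lt (x y : T) : (x < y)%O -> level x < level y.
Proof. by rewrite ltE => /andP[]. Qed.

Lemma level_le4 (x : T) : level x <= 4.
Proof. by case: x => [[]|[x|x]] //=; case: (p x). Qed.

Lemma le_ext0 (x : T) : (ext false <= x)%O.
Proof. by case: x => [[]|[x|x]] //; rewrite leE /=; case: (p x). Qed.

Lemma le_ext1 (x : T) : (x <= ext true)%O.
Proof. by case: x => [[]|[x|x]] //; rewrite leE /=; case: (p x). Qed.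

Lemma incidentC (x y : T) : incident x y = incident y x.
Proof.
case: x => [?|[x|x]]; case: y => [?|[y|y]] //=.
by apply: eq_existsb => e; rewrite (andbC (x \in e)).
Qed.

Lemma incident_comparable (x y : T) :
  level x != level y -> incident x y -> (x >=< y)%O.
Proof.
rewrite neq_ltn => /orP[] lxy ixy; first by rewrite lt_comparable // ltE lxy.
by rewrite gt_comparable // ltE lxy incidentC.
Qed.

(** ** Flags *)

Definition corner (x y : V) (e : block) : {set T} :=
  node x |: (node y |: (blk e |: [set ext false; ext true])).

Definition is_corner x y (e : block) :=
  [/\ p x != p y, x \in val e & y \in val e].

Lemma is_cornerC x y e : is_corner x y e -> is_corner y x e.
Proof. by case=> *; split; rewrite 1?eq_sym. Qed.

Lemma cornerC x y e : corner x y e = corner y x e.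
Proof. by rewrite /corner setUCA. Qed.

Lemma in_corner_node x y e z : (node z \in corner x y e) = (z == x) || (z == y).
Proof. by rewrite !inE /= !orbF. Qed.

Lemma in_corner_blk x y e f : (blk f \in corner x y e) = (f == e).
Proof. by rewrite !inE /= !orbF. Qed.

Lemma in_corner_ext x y e b : ext b \in corner x y e.
Proof. by case: b; rewrite !inE. Qed.

Lemma corner_chain x y e : is_corner x y e -> is_chain (corner x y e).
Proof.
case=> pxy xe ye; apply/chainP => a b.
have E1 : [exists e in E, (x \in e) && (y \in e)].
  by apply/exists_inP; exists (val e); rewrite ?(valP e) ?xe.
have E2 : [exists e in E, (y \in e) && (x \in e)].
  by apply/exists_inP; exists (val e); rewrite ?(valP e) ?xe ?ye.
rewrite !inE => /or4P[|||/orP[]] /eqP-> /or4P[|||/orP[]] /eqP->;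
  rewrite ?comparablexx //; apply: incident_comparable => //=.
all: move: pxy; by case: (p x); case: (p y).
Qed.

Lemma card_corner x y e : is_corner x y e -> #|corner x y e| = 5.
Proof.
case=> pxy _ _; have xy : x != y by apply: contraNneq pxy => ->.
by rewrite /corner !cardsU1 cards1 !inE /= -[inr _ == _]/(x == y) (negPf xy).
Qed.


Hypothesis node0 : V.
Hypothesis covered : forall x, exists2 e, e \in E & x \in e.
Hypothesis half : forall e b, e \in E -> #|[set x in e | p x == b]| = 2.
Hypothesis link : forall e x y, e \in E -> x \in e -> y \in e -> p x != p y ->
  #|[set f in E | (x \in f) && (y \in f)]| = 2.

Lemma block_colour (e : block) b : exists2 x, x \in val e & p x = b.
Proof.
have /card_gt0P[x] : 0 < #|[set x in val e | p x == b]| by rewrite half // (valP e).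
by rewrite inE => /andP[xe /eqP pxb]; exists x.
Qed.

Lemma block_through x : exists e : block, x \in val e.
Proof. by have [e eE xe] := covered x; exists (Sub e eE). Qed.

Lemma block_through2 (e : block) x y :
  x \in val e -> y \in val e -> [exists f in E, (x \in f) && (y \in f)].
Proof. by move=> xe ye; apply/exists_inP; exists (val e); rewrite ?(valP e) ?xe. Qed.

(** Every point lies on a block, and every block has points of both colours. *)
Lemma incident_between (x y : T) r : (x < y)%O -> level x < r < level y ->
  exists z, [/\ level z = r, incident x z & incident z y].
Proof.
case: x => [[]|[x|x]]; case: y => [[]|[y|y]]; rewrite ltE /=; try by [].
all: rewrite ?andbT //.
- by case: (p y).
- move=> _; case: r => [|[|[|[|r]]]] // _.
  + have [e _] := block_through node0; have [u ue pu] := block_colour e false.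
    by exists (node u); rewrite /= pu.
  + by have [e _] := block_through node0; exists (blk e).
  + have [e _] := block_through node0; have [u ue pu] := block_colour e true.
    by exists (node u); rewrite /= pu.
- have [e ye] := block_through y; have [u ue pu] := block_colour e false.
  case: (p y) => _; case: r => [|[|[|r]]] // _.
    by exists (node u); rewrite /= pu (block_through2 ue ye).
  by exists (blk e).
- move=> _; case: r => [|[|r]] // _; have [u ue pu] := block_colour y false.
  by exists (node u); rewrite /= pu.
- have [e xe] := block_through x; have [u ue pu] := block_colour e true.
  case: (p x) => _; case: r => [|[|[|[|r]]]] // _.
    by exists (blk e).
  by exists (node u); rewrite /= pu (block_through2 xe ue).
- case: (p x); case: (p y) => //= /exists_inP[e eE /andP[xe ye]].
  by case: r => [|[|[|r]]] // _; exists (blk (Sub e eE)).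
- by case: (p x) => //= _; case: r => [|[|r]].
- move=> _; case: r => [|[|[|[|r]]]] // _; have [u ue pu] := block_colour x true.
  by exists (node u); rewrite /= pu.
- by case: (p y) => //= _; case: r => [|[|[|r]]].
Qed.

Lemma level_between (x y : T) r : (x < y)%O -> level x < r < level y ->
  exists2 z, (x < z < y)%O & level z = r.
Proof.
move=> xy /andP[xr ry]; have [|z [zr xz zy]] := @incident_between x y r xy.
  by rewrite xr.
by exists z => //; rewrite !ltE zr xr ry xz.
Qed.

Lemma corner_flag x y e : is_corner x y e -> corner x y e \in flags T.
Proof.
move=> xye; apply: (@chain_of_full_card_is_flag _ T 3 level (ext true) erefl
  le_ext1 level_lt); [exact: corner_chain | exact: card_corner].
Qed.

Let flag_level := @flag_lvl_surj _ T 3 level (ext false) (ext true) erefl erefl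
  le_ext0 le_ext1 level_lt level_between.

Lemma card_block_flag (A : {set T}) : A \in flags T -> #|A| = 5.
Proof.
exact: (@card_flag _ T 3 level (ext false) (ext true) erefl erefl
  le_ext0 le_ext1 level_lt level_between).
Qed.

(** A flag has one face of each level; the proper ones form a corner. *)
Lemma flagP (A : {set T}) : A \in flags T ->
  exists x y e, [/\ is_corner x y e, p x = false & A = corner x y e].
Proof.
move=> Afl; have ch : is_chain A by move: Afl; rewrite inE => /maxsetP[].
have [[[]|[x|?]] //= xA] := flag_level Afl (isT : 1 <= 4).
case px: (p x) => // _.
have [[[]|[?|e]] //= eA] := flag_level Afl (isT : 2 <= 4); first by case: (p _).
move=> _; have [[[]|[y|?]] //= yA] := flag_level Afl (isT : 3 <= 4).
case py: (p y) => // _.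
have xye : is_corner x y e.
  split; first by rewrite px py.
    have := chain_lvl_le level_lt ch xA eA; rewrite leE /= px /= => /(_ isT).
    by [].
  have := chain_lvl_le level_lt ch eA yA; rewrite leE /= py /= => /(_ isT).
  by [].
exists x, y, e; split=> //; apply/esym/eqP.
rewrite eqEcard card_corner // card_block_flag //.
rewrite andbT; apply/subsetP => z; rewrite !inE => /or4P[|||/orP[]] /eqP-> //.
  exact: (bot_in_flag le_ext0).
exact: (top_in_flag le_ext1).
Qed.

Lemma block_diamond (F G : T) : (F < G)%O -> level G = (level F).+2 ->
  #|[set H : T | (F < H < G)%O]| = 2.
Proof.
have node_inj : injective node by move=> u w [].
have blk_inj : injective blk by move=> u w [].
case: F => [[]|[x|e]]; case: G => [[]|[y|f]]; rewrite ltE /=; try by [].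
- by case: (p y).
- by case: (p y).
- move=> _ _; rewrite -(half false (valP f)) -(card_imset _ node_inj).
  apply: eq_card => H; rewrite inE; apply/andP/imsetP; last first.
    by case=> u; rewrite inE => /andP[uf /eqP pu] ->; rewrite !ltE /= pu uf.
  rewrite !ltE; case: H => [[]|[u|g]] //=; rewrite ?andbF ?andbT; try by case.
  case=> _ /andP[pu uf]; exists u => //; rewrite inE uf.
  by case: (p u) pu.
- by case: (p x).
- case px: (p x); case py: (p y) => //= /exists_inP[e eE /andP[xe ye]] _.
  have pxy : p x != p y by rewrite px py.
  pose S := [set f : block | (x \in val f) && (y \in val f)].
  transitivity #|S|.
    rewrite -(card_imset _ blk_inj); apply: eq_card => H; rewrite inE; apply/andP/imsetP.
      rewrite !ltE; case: H => [[]|[u|f]] //=; rewrite ?andbF ?px ?py //=; try by case.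
        by case: (p u) => //= -[].
      by case=> xf yf; exists f => //; rewrite inE xf yf.
    by case=> f; rewrite inE => /andP[xf yf] ->; rewrite !ltE /= px py xf.
  rewrite -(link eE xe ye pxy) -(card_imset S val_inj); apply: eq_card => f.
  rewrite inE; apply/imsetP/andP => [[f' + ->]|[fE xyf]].
    by rewrite inE => ->; rewrite (valP f').
  by exists (Sub f fE) => //; rewrite inE.
- by case: (p x).
- move=> _ _; rewrite -(half true (valP e)) -(card_imset _ node_inj).
  apply: eq_card => H; rewrite inE; apply/andP/imsetP; last first.
    by case=> u; rewrite inE => /andP[ue /eqP pu] ->; rewrite !ltE /= pu ue.
  rewrite !ltE; case: H => [[]|[u|g]] //=; rewrite ?andbF ?andbT; try by case.
  case=> /andP[pu ue] _; exists u => //; rewrite inE ue.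
  by case: (p u) pu.
- by case: (p y).
Qed.

(** ** Connectivity *)

Lemma swap_diff (K : {set T}) a b : a \notin K -> a != b ->
  (a |: K) :\: (b |: K) = [set a].
Proof.
move=> aK ab; apply/setP => z; rewrite !inE; have [->|za] := eqVneq z a.
  by rewrite (negPf ab) (negPf aK).
by rewrite /=; case: (z \in K); rewrite ?orbT ?andbF.
Qed.


Lemma corner_node_diff x x' y e : is_corner x y e -> x != x' ->
  corner x y e :\: corner x' y e = [set node x].
Proof.
case=> pxy _ _ xx'; apply: swap_diff => //; rewrite !inE /= !orbF.
by apply: contraNneq pxy => -[->].
Qed.

Lemma corner_blk_diff x y e f : e != f ->
  corner x y e :\: corner x y f = [set blk e].
Proof.
have blkE g : corner x y g = blk g |: (node x |: (node y |: [set ext false; ext true])).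
  by rewrite /corner (setUCA [set node y]) setUCA.
by move=> ef; rewrite !blkE; apply: swap_diff => //; rewrite !inE.
Qed.

Lemma adjacent_diff (A B : {set T}) a b :
  A :\: B = [set a] -> B :\: A = [set b] -> adjacent A B.
Proof. by rewrite /adjacent => -> ->; rewrite !cards1. Qed.

Lemma adjacent_node x x' y e : is_corner x y e -> is_corner x' y e -> x != x' ->
  adjacent (corner x y e) (corner x' y e).
Proof.
move=> xye x'ye xx'; apply: adjacent_diff (corner_node_diff xye xx') _.
by apply: corner_node_diff; rewrite 1?eq_sym.
Qed.

Lemma adjacent_blk x y e f : e != f -> adjacent (corner x y e) (corner x y f).
Proof.
move=> ef; apply: adjacent_diff (corner_blk_diff _ _ ef) _.
by apply: corner_blk_diff; rewrite 1?eq_sym.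
Qed.

Definition flag_step (X : {set T}) : rel {set T} := [rel A B |
  [&& A \in flags T, B \in flags T, X \subset A, X \subset B & adjacent A B]].

Lemma flag_step_sym X : symmetric (flag_step X).
Proof.
move=> A B; rewrite /flag_step /= /adjacent (andbC (#|B :\: A| == 1)).
by do ![case: (_ \in _) | case: (_ \subset _)].
Qed.

(** Being joined by flags that contain a fixed set X is connectedness for the
    symmetric relation [flag_step X]; here X is the intersection of the ends. *)
Lemma connect_joined (A B : {set T}) : A \in flags T ->
  connect (flag_step (A :&: B)) A B -> exists s, joined_by A s B.
Proof.
move=> Afl /connectP[s sP eB]; exists s; split=> //.
  by apply: sub_path sP => C D /and5P[].
move: Afl (subsetIl A B) sP; move: (A :&: B) => X {eB B}.
elim: s A => [|D s IHs] A Afl XA /=; first by move=> _ C; rewrite inE => /eqP->.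
case/andP=> /and5P[_ Dfl _ XD _] sP C; rewrite inE => /predU1P[-> //|].
exact: IHs.
Qed.

Lemma connect_flag_stepW (X Y : {set T}) A B : Y \subset X ->
  connect (flag_step X) A B -> connect (flag_step Y) A B.
Proof.
move=> YX; apply: connect_sub => C D /and5P[Cfl Dfl XC XD CD]; apply: connect1.
by rewrite /flag_step /= Cfl Dfl CD !(subset_trans YX).
Qed.

Definition node_flag_base x : {set T} := node x |: [set ext false; ext true].

Hypothesis around_node : forall x y e y' e', is_corner x y e -> is_corner x y' e' ->
  connect (flag_step (node_flag_base x)) (corner x y e) (corner x y' e').
Hypothesis all_connected : forall A B, A \in flags T -> B \in flags T ->
  connect (flag_step [set ext false; ext true]) A B.

(** Flags that share their block are joined by exchanging one point at a time.
    Flags with different blocks that share both points are adjacent; if they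
    share one point or none, the two connectivity hypotheses apply. *)
Lemma block_strongly_connected (A B : {set T}) : A \in flags T -> B \in flags T ->
  exists s, joined_by A s B.
Proof.
move=> Afl Bfl; apply: connect_joined => //.
have [x [y [e [xye px eA]]]] := flagP Afl.
have [x' [y' [e' [xye' px' eB]]]] := flagP Bfl.
have [pxy xe ye] := xye; have [pxy' xe' ye'] := xye'.
have xy' : x == y' = false by apply: contraNF pxy' => /eqP<-; rewrite px px'.
have yx' : y == x' = false by apply: contraNF pxy => /eqP->; rewrite px px'.
have memA z : z \in A -> [\/ z = node x, z = node y, z = blk e | exists b, z = ext b].
  rewrite eA !inE => /or4P[|||/orP[]] /eqP->; try by [constructor].
    by constructor 4; exists false.
  by constructor 4; exists true.
have IS : forall Y : {set T}, (node x \in B -> node x \in Y) ->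
    (node y \in B -> node y \in Y) -> (blk e \in B -> blk e \in Y) ->
    (forall b, ext b \in Y) -> A :&: B \subset Y.
  move=> Y Yx Yy Ye Yext; apply/subsetP => z /setIP[/memA + zB].
  by case=> [zE|zE|zE|[b ->]]; rewrite ?Yext // zE in zB *; auto.
have [ee|ee] := eqVneq e e'.
  have [_ _ y'e'] := xye'; subst e'.
  have xyD : is_corner x' y e by split; rewrite // px' -px.
  have Dfl := corner_flag xyD.
  have DX : A :&: B \subset corner x' y e.
    apply: IS => [||_|b]; rewrite ?in_corner_ext ?in_corner_blk ?in_corner_node //.
      by rewrite eB in_corner_node xy' orbF => ->.
    by rewrite eqxx orbT.
  apply: (@connect_trans _ _ (corner x' y e)).
    have [exx|nxx] := eqVneq x x'; first by rewrite eA exx connect0.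
    apply: connect1; rewrite /flag_step /= Afl Dfl DX subsetIl eA.
    exact: adjacent_node.
  have [eyy|nyy] := eqVneq y y'; first by rewrite eB eyy connect0.
  apply: connect1; rewrite /flag_step /= Bfl Dfl DX subsetIr eB !(cornerC x').
  by apply: adjacent_node nyy; apply: is_cornerC.
have beB : blk e \in B = false by rewrite eB in_corner_blk (negPf ee).
have [exx|nxx] := eqVneq x x'.
  have [eyy|nyy] := eqVneq y y'.
    apply: connect1; rewrite /flag_step /= Afl Bfl subsetIl subsetIr eA eB -exx -eyy.
    exact: adjacent_blk.
  apply: (@connect_flag_stepW (node_flag_base x)).
    apply: IS => [_|||b]; rewrite ?beB ?setU11 //; last by case: b; rewrite !inE.
    by rewrite eB in_corner_node yx' (negPf nyy).
  by rewrite eA eB -exx; apply: around_node => //; rewrite exx.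
have [eyy|nyy] := eqVneq y y'.
  apply: (@connect_flag_stepW (node_flag_base y)).
    apply: IS => [|_||b]; rewrite ?beB ?setU11 //; last by case: b; rewrite !inE.
    by rewrite eB in_corner_node xy' (negPf nxx).
  rewrite eA eB (cornerC x) (cornerC x') -eyy; apply: around_node; apply: is_cornerC => //.
  by rewrite eyy.
apply: (@connect_flag_stepW [set ext false; ext true]); last exact: all_connected.
apply: IS => [|||b]; rewrite ?beB //; last by case: b; rewrite !inE.
  by rewrite eB in_corner_node xy' (negPf nxx).
by rewrite eB in_corner_node yx' (negPf nyy).
Qed.

Lemma block_is_polytope : is_polytope block_rank 3.
Proof.
split.
- move=> x; have := level_le4 x; rewrite /block_rank.
  by case: (level x) => [|[|[|[|[|k]]]]].
- by move=> x y /level_lt xy; rewrite /block_rank ltrD2r ltz_nat.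
- exists (ext false), (ext true); split=> //.
  + move=> x; split=> [/(_ _ (le_ext0 x)) //|-> y y0].
    by apply/le_anti; rewrite y0 le_ext0.
  + move=> x; split=> [/(_ _ (le_ext1 x)) //|-> y y0].
    by apply/le_anti; rewrite y0 le_ext1.
  + move=> A Afl; rewrite card_block_flag //; split=> //.
      exact: (bot_in_flag le_ext0).
    exact: (top_in_flag le_ext1).
- move=> F G FG FG2; apply: block_diamond => //.
  move: FG2; rewrite /block_rank opprB addrA subrK => /eqP.
  by rewrite subr_eq => /eqP[->].
- by move=> A B Afl Bfl; apply: block_strongly_connected.
Qed.

End BlockPoset.

(** * Symmetries induced from the block system *)

Section Symmetries.
Variables (V : finType) (p : V -> bool) (E : {set {set V}}).
Local Notation T := (block_poset E p).

(** The boolean tells whether the two colours are exchanged. *)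
Definition symmetry (b : bool) (g : {perm V}) : Prop :=
  (forall e, e \in E -> g @: e \in E) /\ (forall x, p (g x) = b (+) p x).

Definition act (b : bool) (g : {perm V}) (t : T) : T :=
  match t with
  | inl c => ext p E (b (+) c)
  | inr (inl x) => node p E (g x)
  | inr (inr e) => blk p (insubd e (g @: val e))
  end.

(** The identity is a dummy value for g not a symmetry; lifting thus takes no
    proof argument. *)
Definition lift (b : bool) (g : {perm V}) : {perm T} :=
  odflt 1%g (insub [ffun t : T => act b g t] : option {perm T}).

Section OneSymmetry.
Variables (b : bool) (g : {perm V}).
Hypothesis gS : symmetry b g.

Lemma val_act_blk (e : block E) : val (insubd e (g @: val e)) = g @: val e.
Proof. by rewrite val_insubd gS.1 // (valP e). Qed.

Lemma act_inj : injective (act b g).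
Proof.
move=> [c|[x|e]] [c'|[x'|e']] //= [].
- by move/addbI->.
- by move/perm_inj->.
- by move/(congr1 val); rewrite !val_act_blk => /(imset_inj perm_inj)/val_inj->.
Qed.

Lemma liftE t : lift b g t = act b g t.
Proof.
have actI : injectiveb [ffun t => act b g t].
  by apply/injectiveP => x y; rewrite !ffunE => /act_inj.
by rewrite /lift insubT /= -pvalE /= ffunE.
Qed.

(** The image map is injective on the finite set of blocks. *)
Lemma symmetry_imset_onto e : e \in E -> exists2 f, f \in E & e = g @: f.
Proof.
suff EE : E = [set g @: f | f : {set V} in E] by rewrite {1}EE => /imsetP.
apply/esym/eqP; rewrite eqEcard card_imset ?leqnn ?andbT; last exact: imset_inj perm_inj.
by apply/subsetP => _ /imsetP[f fE ->]; apply: gS.1.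
Qed.

Lemma level_act t : level (act b g t) = if b then 4 - level t else level t.
Proof.
case: t => [c|[x|e]] /=; rewrite ?gS.2; case: b => //; first by case: c.
by case: (p x).
Qed.

Lemma incident_act s t : incident (act b g s) (act b g t) = incident s t.
Proof.
have gI (A : {set V}) z : (g z \in g @: A) = (z \in A) by apply: mem_imset perm_inj.
case: s => [c|[x|e]]; case: t => [c'|[y|f]] //=; rewrite -?/(val _) ?val_act_blk ?gI //.
  apply/exists_inP/exists_inP => -[e eE xye].
    by have [f fE eE'] := symmetry_imset_onto eE; exists f;
      rewrite // -(gI f x) -(gI f y) -eE'.
  by exists (g @: e); rewrite ?gI // gS.1.
by rewrite -val_eqE /= -!/(val _) !val_act_blk (inj_eq (imset_inj perm_inj)).
Qed.

End OneSymmetry.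

Lemma act_mono g : symmetry false g -> {mono act false g : x y / (x <= y)%O}.
Proof.
by move=> gS x y; rewrite !leE !level_act // incident_act // (inj_eq (act_inj gS)).
Qed.

Lemma act_dual_mono g : symmetry true g ->
  forall x y, (act true g y <= act true g x)%O = (x <= y)%O.
Proof.
move=> gS x y; rewrite !leE !level_act // incident_act // (inj_eq (act_inj gS)).
by rewrite ltn_sub2lE ?level_le4 // eq_sym incidentC.
Qed.

Lemma lift_aut g : symmetry false g -> lift false g \in polytope_aut (@block_rank V p E).
Proof.
move=> gS; rewrite inE; apply/andP; split.
  by apply/forallP => x; apply/forallP => y; rewrite !liftE // act_mono.
by apply/forallP => x; rewrite liftE // /block_rank level_act.
Qed.

Lemma block_self_dual g : symmetry true g -> self_dual 3 (@block_rank V p E).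
Proof.
move=> gS; exists (act true g : T -> T^d); split.
- exact: injF_bij (act_inj gS).
- by move=> x y; rewrite leEdual act_dual_mono.
- move=> x; rewrite /dual_rank /block_rank level_act //.
  by have := level_le4 x; case: (level x) => [|[|[|[|[|k]]]]].
Qed.

Lemma lift_corner g x y (e f : block E) : symmetry false g -> val f = g @: val e ->
  lift false g @: corner p x y e = corner p (g x) (g y) f.
Proof.
move=> gS fE; rewrite /corner !imsetU !imset_set1 !liftE //=.
congr (_ :|: (_ :|: (_ :|: _))); congr [set blk _ _].
by apply: val_inj; rewrite (val_act_blk gS) fE.
Qed.

Lemma symmetry1 : symmetry false 1.
Proof. by split=> [e eE|x]; rewrite ?perm1 // (eq_imset _ (@perm1 _)) imset_id. Qed.

Lemma symmetryM g h : symmetry false g -> symmetry false h -> symmetry false (g * h)%g.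
Proof.
move=> gS hS; split=> [e eE|x]; last by rewrite permM hS.2 gS.2.
by rewrite (eq_imset _ (permM g h)) (imset_comp h g); apply/hS.1/gS.1.
Qed.

Lemma lift1 : lift false 1 = 1%g.
Proof.
apply/permP => t; rewrite liftE ?perm1; last exact: symmetry1.
case: t => [c|[x|e]] //=; rewrite ?perm1 //; congr blk; apply: val_inj.
by rewrite (val_act_blk symmetry1) (eq_imset _ (@perm1 _)) imset_id.
Qed.

Lemma liftM g h : symmetry false g -> symmetry false h ->
  lift false (g * h)%g = (lift false g * lift false h)%g.
Proof.
move=> gS hS; have ghS := symmetryM gS hS; apply/permP => t; rewrite permM !liftE //.
case: t => [c|[x|e]] //=; rewrite ?permM //; congr blk; apply: val_inj.
rewrite (val_act_blk hS) (val_act_blk gS) (val_act_blk ghS) -imset_comp.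
by apply: eq_imset => z; rewrite permM.
Qed.

(** Lifting is an injective morphism: g is recovered from its action on points. *)
Lemma order_lift g : symmetry false g -> #[lift false g]%g = #[g]%g.
Proof.
move=> gS.
have liftX k : symmetry false (g ^+ k)%g /\
    lift false (g ^+ k)%g = (lift false g ^+ k)%g.
  elim: k => [|k [IHS IHk]]; first by split; [exact: symmetry1 | exact: lift1].
  by rewrite !expgS -IHk; split; [exact: symmetryM | exact: liftM].
apply/eqP; rewrite eqn_dvd !order_dvdn; apply/andP; split; apply/eqP.
  by rewrite -(liftX _).2 expg_order lift1.
apply/permP => x.
have := congr1 (fun h : {perm T} => h (node p E x)) (expg_order (lift false g)).
by rewrite -(liftX _).2 (liftE (liftX _).1) !perm1 => -[].
Qed.

(** Lifts need only reach every flag from one: all automorphisms preserve flags. *)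
Lemma block_regular A : A \in flags T ->
  (forall B, B \in flags T -> exists2 g, symmetry false g & B = lift false g @: A) ->
  is_regular (@block_rank V p E).
Proof.
move=> Afl tr; apply/imsetP; exists A => //; apply/setP => B.
apply/idP/orbitP => [/tr[g gS ->]|[h hA <-]].
  by exists (lift false g); [exact: lift_aut | rewrite /= setactE].
rewrite /= setactE; apply: aut_flag => // x y.
by move: hA; rewrite inE => /andP[/forallP/(_ x)/forallP/(_ y)/eqP].
Qed.

Lemma generator_node g x y e : symmetry false g -> is_corner p x y e ->
  g @: val e = val e -> g y = y -> g x != x ->
  let A := corner p x y e in
  lift false g \in polytope_aut (@block_rank V p E) /\
  i_adjacent (@block_rank V p E) (level (node p E x)).-1 A (lift false g @: A).
Proof.
move=> gS xye ge gy gx A; split; first exact: lift_aut.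
have gxye : is_corner p (g x) y e.
  case: xye => pxy xe ye; split=> //; first by rewrite gS.2.
  by rewrite -ge imset_f.
rewrite (lift_corner _ _ gS (esym ge)) gy; split.
  by apply: adjacent_node; rewrite // eq_sym.
rewrite !corner_node_diff // 1?eq_sym // => z; rewrite !inE => /orP[]/eqP->.
  by rewrite /block_rank /=; case: (p x).
by rewrite /block_rank /= gS.2; case: (p x).
Qed.

Lemma generator_blk g x y (e f : block E) : symmetry false g -> is_corner p x y e ->
  val f = g @: val e -> g x = x -> g y = y -> f != e ->
  let A := corner p x y e in
  lift false g \in polytope_aut (@block_rank V p E) /\
  i_adjacent (@block_rank V p E) 1 A (lift false g @: A).
Proof.
move=> gS xye fE gx gy fe A; split; first exact: lift_aut.
rewrite (lift_corner _ _ gS fE) gx gy; split.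
  by apply: adjacent_blk; rewrite // eq_sym.
by rewrite !corner_blk_diff // 1?eq_sym // => z; rewrite !inE => /orP[]/eqP->.
Qed.

End Symmetries.

(** * The squares of the n-cube in cyclically consecutive directions *)

Section Cube.
Variable m : nat.
Local Notation I := 'I_m.+3.
Local Notation V := {ffun I -> bool}.
Local Open Scope ring_scope.

Definition unit_vec (i : I) : V := [ffun j => j == i].
Local Notation e := unit_vec.

Definition parity (x : V) : bool := \sum_i x i.
Local Notation p := parity.

Lemma addvv (x : V) : x + x = 0.
Proof. by apply/ffunP => i; rewrite !ffunE; case: (x i). Qed.

Lemma addvK (x y : V) : x + y + y = x.
Proof. by rewrite -addrA addvv addr0. Qed.

Lemma parityD x y : p (x + y) = p x (+) p y.
Proof.
by rewrite /parity -[RHS]/(_ + _) -big_split; apply: eq_bigr => i _; rewrite ffunE.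
Qed.

Lemma parity0 : p 0 = false.
Proof. by rewrite /parity big1 // => i _; rewrite ffunE. Qed.

Lemma parity_unit i : p (e i) = true.
Proof.
rewrite /parity (bigD1 i) //= big1 ?ffunE ?eqxx // => j ji.
by rewrite ffunE (negPf ji).
Qed.

Lemma parity_flip x i : p (x + e i) = ~~ p x.
Proof. by rewrite parityD parity_unit addbT. Qed.

Lemma unit_vec_inj : injective e.
Proof. by move=> i j /ffunP/(_ i); rewrite !ffunE eqxx => /esym/eqP. Qed.

Lemma flip_neq x i : x + e i != x.
Proof. by apply/eqP => /(congr1 p); rewrite parity_flip; case: (p x). Qed.

(** ** Squares *)

Definition square (x : V) (i j : I) : {set V} :=
  [set y : V | [forall k, (k != i) ==> (k != j) ==> (y k == x k)]].

Lemma squareP (x y : V) i j :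
  reflect (forall k, k != i -> k != j -> y k = x k) (y \in square x i j).
Proof.
rewrite inE; apply: (iffP forallP) => H k.
  by move=> ki kj; have := H k; rewrite ki kj => /eqP.
by apply/implyP => ki; apply/implyP => kj; rewrite H.
Qed.

Lemma squareC x i j : square x i j = square x j i.
Proof. by apply/setP => y; apply/squareP/squareP => H k ki kj; apply: H. Qed.

Lemma square_refl x i j : x \in square x i j.
Proof. exact/squareP. Qed.

Lemma square_flip x i j : x + e i \in square x i j.
Proof. by apply/squareP => k ki kj; rewrite !ffunE (negPf ki) addr0. Qed.

Lemma square_base x i j y : y \in square x i j -> square x i j = square y i j.
Proof.
move/squareP => yx; apply/setP => z; apply/squareP/squareP => H k ki kj.
  by rewrite H // yx.
by rewrite H // -yx.
Qed.

(** A point of the square is known by whether it agrees with x at i and at j. *)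
Lemma squareE x i j : i != j -> square x i j = [set x; x + e i; x + e j; x + e i + e j].
Proof.
move=> ij; apply/setP => y; apply/idP/idP => [/squareP yP|]; last first.
  case/setUP => [/setUP[/set2P[]|/set1P]|/set1P] ->; first exact: square_refl.
  - exact: square_flip.
  - by rewrite squareC square_flip.
  - by rewrite (square_base (square_flip x i j)) squareC square_flip.
have yE (u : V) : (forall k, k != i -> k != j -> u k = x k) ->
    u i = y i -> u j = y j -> y = u.
  move=> uP ui uj; apply/ffunP => k; have [->//|ki] := eqVneq k i.
  by have [->//|kj] := eqVneq k j; rewrite yP ?uP.
rewrite !inE -!orbA; apply/or4P.
case yi: (y i == x i); case yj: (y j == x j).
- constructor 1; apply/eqP/yE => //; exact/esym/eqP.
- constructor 3; apply/eqP/yE => [k ki kj||]; rewrite !ffunE.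
  + by rewrite (negPf kj) addr0.
  + by rewrite (negPf ij) addr0 (eqP yi).
  + by rewrite eqxx; move: yj; case: (y j); case: (x j).
- constructor 2; apply/eqP/yE => [k ki kj||]; rewrite !ffunE.
  + by rewrite (negPf ki) addr0.
  + by rewrite eqxx; move: yi; case: (y i); case: (x i).
  + by rewrite eq_sym (negPf ij) addr0 (eqP yj).
- constructor 4; apply/eqP/yE => [k ki kj||]; rewrite !ffunE.
  + by rewrite (negPf ki) (negPf kj) !addr0.
  + by rewrite eqxx (negPf ij) addr0; move: yi; case: (y i); case: (x i).
  + by rewrite eqxx eq_sym (negPf ij) addr0; move: yj; case: (y j); case: (x j).
Qed.

Lemma square_dir_inj x i j k : j != i -> square x i j = square x i k -> j = k.
Proof.
move=> ji /setP/(_ (x + e j)); rewrite squareC square_flip => /esym/squareP/(_ j ji) H.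
apply/eqP; apply: contraT => /H; rewrite !ffunE eqxx; by case: (x j).
Qed.

(** The two neighbours of a direction in the cyclic order. *)
Definition turn (i : I) (b : bool) : I := i + (-1) ^+ b.

Lemma turn_neq i b : turn i b != i.
Proof. by rewrite /turn -subr_eq0 addrAC subrr add0r signr_eq0. Qed.

(** This is where n is at least 3: the two neighbours of a direction differ. *)
Lemma turn_inj i : injective (turn i).
Proof.
have two : (1 + 1 : I) != 0.
  by [].
move=> b c /addrI; case: b; case: c => //= /eqP.
  by rewrite expr0 expr1 eq_sym -subr_eq0 opprK (negPf two).
by rewrite expr0 expr1 -subr_eq0 opprK (negPf two).
Qed.

Lemma turnK i b : turn (turn i b) (~~ b) = i.
Proof. by rewrite /turn signrN addrK. Qed.

Definition squares : {set {set V}} := [set square xi.1 xi.2 (turn xi.2 false) | xi : V * I].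
Local Notation E := squares.

Lemma square_in x i b : square x i (turn i b) \in E.
Proof.
apply/imsetP; case: b; last by exists (x, i).
by exists (x, turn i true); rewrite //= (turnK i true) squareC.
Qed.

(** The four points of a square alternate in parity, so points of different parity
    are joined by a side, and the square turns left or right from that side. *)
Lemma square_corner Q x y : Q \in E -> x \in Q -> y \in Q -> p x != p y ->
  exists i b, y = x + e i /\ Q = square x i (turn i b).
Proof.
case/imsetP => -[z k] _ -> /= xQ; rewrite (square_base xQ) {z xQ}.
move=> yQ pxy; have tk : k != turn k false by rewrite eq_sym turn_neq.
move: yQ; rewrite {1}(squareE _ tk).
case/setUP => [/setUP[/set2P[]|/set1P]|/set1P] yE.
- by rewrite yE eqxx in pxy.
- by exists k, false.
- by exists (turn k false), true; rewrite (turnK k false) squareC.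
- by rewrite yE !parity_flip negbK eqxx in pxy.
Qed.

Lemma square_covers x : exists2 Q, Q \in E & x \in Q.
Proof. by exists (square x 0 (turn 0 false)); rewrite ?square_in ?square_refl. Qed.

Lemma square_half Q b : Q \in E -> #|[set x in Q | p x == b]| = 2.
Proof.
case/imsetP => -[x i] _ -> /=; set j := turn i false.
have ij : i != j by rewrite eq_sym turn_neq.
have [pxb|pxb] := eqVneq (p x) b.
  have -> : [set y in square x i j | p y == b] = [set x; x + e i + e j].
    apply/setP => y; rewrite squareE // !inE -!orbA.
    apply/andP/orP => [[/or4P[] /eqP-> //]|[] /eqP->];
      rewrite ?parity_flip ?pxb ?negbK ?eqxx ?orbT; auto.
    - by case: (b).
    - by case: (b).
  rewrite cards2 -addrA eq_sym -subr_eq0 addrAC subrr add0r.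
  by rewrite addr_eq0 -[- _]addr0 -(addvv (e j)) addKr (inj_eq unit_vec_inj) ij.
have -> : [set y in square x i j | p y == b] = [set x + e i; x + e j].
  apply/setP => y; rewrite squareE // !inE -!orbA.
  apply/andP/orP => [[/or4P[] /eqP-> //]|[] /eqP->];
    rewrite ?parity_flip ?negbK ?(negPf pxb) ?eqxx ?orbT //;
    do [by auto | by split=> //; move: pxb; case: (b); case: (p x)].
by rewrite cards2 (inj_eq (addrI x)) (inj_eq unit_vec_inj) ij.
Qed.

(** The squares on the cube edge in direction i are those in directions i, i + 1
    and i, i - 1. *)
Lemma square_link Q x y : Q \in E -> x \in Q -> y \in Q -> p x != p y ->
  #|[set R in E | (x \in R) && (y \in R)]| = 2.
Proof.
move=> QE xQ yQ pxy; have [i [b [yE _]]] := square_corner QE xQ yQ pxy.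
have -> : [set R in E | (x \in R) && (y \in R)] =
          [set square x i (turn i false); square x i (turn i true)].
  apply/setP => R; rewrite !inE; apply/and3P/orP => [[RE xR yR]|].
    have [j [c [yE' ->]]] := square_corner RE xR yR pxy.
    have -> : j = i by apply/unit_vec_inj/(addrI x); rewrite -yE'.
    by case: c; rewrite eqxx; auto.
  by case=> /eqP->; rewrite square_in square_refl yE square_flip.
rewrite cards2; case: eqP => // /(square_dir_inj (turn_neq i false)).
by move/turn_inj.
Qed.

(** ** Symmetries of the cube that preserve the cyclic order of directions *)

Section CubeSymmetry.
Variables (c : V) (i : I) (b : bool).

Definition dihedral (j : I) : I := i + (-1) ^+ b * j.
Definition dihedral_inv (j : I) : I := (-1) ^+ b * (j - i).

Lemma dihedralK : cancel dihedral dihedral_inv.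
Proof. by move=> j; rewrite /dihedral_inv /dihedral addrAC subrr add0r signrMK. Qed.

Lemma dihedral_invK : cancel dihedral_inv dihedral.
Proof. by move=> j; rewrite /dihedral /dihedral_inv signrMK addrC subrK. Qed.

Definition cube_map (x : V) : V := [ffun j => c j + x (dihedral_inv j)].

Lemma cube_map_inj : injective cube_map.
Proof.
move=> x y /ffunP xy; apply/ffunP => j; have := xy (dihedral j).
by rewrite !ffunE dihedralK => /addrI.
Qed.

Definition cube_sym : {perm V} := perm cube_map_inj.

Lemma cube_symE x j : cube_sym x j = c j + x (dihedral_inv j).
Proof. by rewrite permE ffunE. Qed.

Lemma cube_sym0 : cube_sym 0 = c.
Proof. by apply/ffunP => j; rewrite cube_symE ffunE addr0. Qed.

Lemma cube_sym_flip x k : cube_sym (x + e k) = cube_sym x + e (dihedral k).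
Proof.
apply/ffunP => j; rewrite ffunE !cube_symE !ffunE addrA; congr (_ + _).
by rewrite (can2_eq dihedral_invK dihedralK).
Qed.

Lemma cube_sym_square x j k : j != k ->
  cube_sym @: square x j k = square (cube_sym x) (dihedral j) (dihedral k).
Proof.
move=> jk; rewrite !squareE ?(inj_eq (can_inj dihedralK)) //.
by rewrite !imsetU !imset_set1 !cube_sym_flip.
Qed.

Lemma dihedral_turn j d : dihedral (turn j d) = turn (dihedral j) (b (+) d).
Proof. by rewrite /dihedral /turn mulrDr addrA signr_addb. Qed.

Lemma cube_symmetry : symmetry p E (p c) cube_sym.
Proof.
split=> [_ /imsetP[[x j] _ ->]|x] /=.
  by rewrite cube_sym_square 1?eq_sym ?turn_neq // dihedral_turn square_in.
have -> : p x = \sum_j x (dihedral_inv j) by exact: reindex_inj (can_inj dihedral_invK).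
by rewrite /parity -[RHS]/(_ + _) -big_split; apply: eq_bigr => j _; rewrite cube_symE.
Qed.

End CubeSymmetry.

(** ** Flags of the polytope *)

Local Notation T := (block_poset E p).

Definition square_block x i b : block E := Sub (square x i (turn i b)) (square_in x i b).

(** The flag of the cube edge from x in direction i and of the square in
    directions i and [turn i b]. *)
Definition cube_flag x i b : {set T} := corner p x (x + e i) (square_block x i b).

Lemma square_block_corner x i b : is_corner p x (x + e i) (square_block x i b).
Proof.
split; rewrite ?square_refl ?square_flip // parity_flip.
by case: (p x).
Qed.

Lemma cube_flag_in x i b : cube_flag x i b \in flags T.
Proof. exact/corner_flag/square_block_corner. Qed.

Lemma corner_cube_flag x y (Q : block E) : is_corner p x y Q ->
  exists i b, corner p x y Q = cube_flag x i b.
Proof.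
case=> pxy xQ yQ; have [i [b [-> QE]]] := square_corner (valP Q) xQ yQ pxy.
by exists i, b; congr corner; apply: val_inj.
Qed.

Lemma cube_flagP A : A \in flags T -> exists x i b, p x = false /\ A = cube_flag x i b.
Proof.
case/(flagP (0 : V) square_covers square_half) => x [y [Q [xyQ px ->]]].
by have [i [b ->]] := corner_cube_flag xyQ; exists x, i, b.
Qed.

Lemma cube_flag_flip x i b : cube_flag (x + e i) i b = cube_flag x i b.
Proof.
rewrite /cube_flag addvK cornerC; congr corner; apply: val_inj => /=.
by rewrite -(square_base (square_flip _ _ _)).
Qed.

(** With x fixed, the flag (i, b) is adjacent to (i, ~~ b) by exchanging the square,
    and (i, false) to (i + 1, true) by exchanging the other end of the cube edge.
    Alternating the two moves visits all directions. *)
Lemma connect_around x i b j c :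
  connect (flag_step (node_flag_base p E x)) (cube_flag x i b) (cube_flag x j c).
Proof.
set R := flag_step _.
have base y k d : node_flag_base p E y \subset cube_flag y k d.
  by rewrite /cube_flag /corner setUS // setUA subsetUr.
have swap k d d' : connect R (cube_flag x k d) (cube_flag x k d').
  have [->|dd'] := eqVneq d d'; first exact: connect0.
  apply: connect1; rewrite /R /flag_step /= !cube_flag_in !base adjacent_blk //.
  apply: contra dd' => /eqP/(congr1 val) /= /(square_dir_inj (turn_neq k d)).
  by move/turn_inj->.
have next k d : connect R (cube_flag x k d) (cube_flag x (k + 1) d).
  apply: (connect_trans (swap k d false)); apply: connect_trans (swap _ true d).
  apply: connect1; rewrite /R /flag_step /= !cube_flag_in !base /=.
  have same : square_block x (k + 1) true = square_block x k false.
    by apply: val_inj; rewrite /= (turnK k false) squareC.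
  have := square_block_corner x (k + 1) true.
  rewrite /cube_flag same => k1; rewrite !(cornerC _ x).
  apply: adjacent_node; [exact/is_cornerC/square_block_corner|exact: is_cornerC|].
  by rewrite (inj_eq (addrI x)) (inj_eq unit_vec_inj) eq_sym (turn_neq k false).
have reach k d : connect R (cube_flag x 0 d) (cube_flag x k d).
  (* Iterate [next], as every direction is a multiple of 1. *)
  rewrite -[k]natr_Zp; elim: (k : nat) => [|l IHl]; first exact: connect0.
  by apply: connect_trans IHl _; rewrite mulrSr.
have Rsym : connect_sym R by apply: sym_connect_sym; apply: flag_step_sym.
apply: connect_trans (swap j b c); apply: connect_trans (reach j b).
by rewrite Rsym.
Qed.

(** A flag on the cube edge from x to x + e_k is a flag through both ends, so the
    flags through x are connected to those through x + e_k, and any vector is a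
    sum of unit vectors. *)
Lemma connect_all A B : A \in flags T -> B \in flags T ->
  connect (flag_step [set ext p E false; ext p E true]) A B.
Proof.
set R := flag_step _.
have around x i b j c : connect R (cube_flag x i b) (cube_flag x j c).
  by apply: connect_flag_stepW (connect_around x i b j c); apply: subsetUr.
have reach x i b j c : connect R (cube_flag 0 i b) (cube_flag x j c).
  have -> : x = \sum_(k | x k) e k.
    apply/ffunP => k; rewrite sum_ffunE; case xk: (x k).
      rewrite (bigD1 k) //= big1 ?ffunE ?eqxx // => l /andP[_ lk].
      by rewrite ffunE eq_sym (negPf lk).
    by rewrite big1 // => l xl; rewrite ffunE; apply: contraTF xl => /eqP<-; rewrite xk.
  elim/big_rec: _ j c => [|k y _ IHy] j c; first exact: around.
  apply: connect_trans (IHy k c) _.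
  by rewrite -cube_flag_flip addrC; apply: around.
have Rsym : connect_sym R by apply: sym_connect_sym; apply: flag_step_sym.
move=> /cube_flagP[x [i [b [_ ->]]]] /cube_flagP[y [j [c [_ ->]]]].
by apply: connect_trans (reach y 0 b j c); rewrite Rsym.
Qed.

Lemma cube_polytope : is_polytope (@block_rank V p E) 3.
Proof.
apply: (block_is_polytope (0 : V) square_covers square_half square_link);
  last exact: connect_all.
move=> x y Q y' Q' /corner_cube_flag[i [b ->]] /corner_cube_flag[i' [b' ->]].
exact: connect_around.
Qed.

(** Every flag is written as [cube_flag x i b] from either end x of its cube edge;
    asking that b be the parity of x selects one end. *)
Lemma card_cube_flags : #|flags T| = (2 ^ m.+3 * m.+3)%N.
Proof.
pose f (xi : V * I) := cube_flag xi.1 xi.2 (p xi.1).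
have -> : flags T = f @: setT.
  apply/setP => A; apply/idP/imsetP => [|[xi _ ->]]; last exact: cube_flag_in.
  case/cube_flagP => x [i [b [px ->]]].
  case: b; last by exists (x, i); rewrite // /f /= px.
  by exists (x + e i, i); rewrite // /f /= parity_flip px cube_flag_flip.
rewrite card_imset; first by rewrite cardsT card_prod card_ffun card_bool card_ord.
have edge x i z : (node p E z \in cube_flag x i (p x)) = (z == x) || (z == x + e i).
  exact: in_corner_node.
move=> [x i] [y j]; rewrite /f /= => fE.
have := edge x i x; rewrite fE edge eqxx => /orP[] /eqP xE.
  congr (_, _) => //; have := edge x i (x + e i).
  rewrite fE edge -xE eqxx orbT (negPf (flip_neq x i)) => /eqP.
  by move/addrI/unit_vec_inj.
have := edge y j y; rewrite -fE edge eqxx xE eq_sym (negPf (flip_neq y j)) /=.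
move=> /eqP; rewrite -addrA -{1}[y]addr0 => /addrI/esym/eqP.
rewrite addr_eq0 -[- _]addr0 -(addvv (e i)) addKr => /eqP/unit_vec_inj ji.
have : blk p (square_block y j (~~ p y)) \in cube_flag y j (p y).
  by rewrite -fE -ji xE cube_flag_flip parity_flip in_corner_blk.
rewrite in_corner_blk => /eqP/(congr1 val)/(square_dir_inj (turn_neq _ _))/turn_inj.
by case: (p y).
Qed.

(** ** Regularity, self-duality and type *)

Lemma cube_sym_unit x i b : cube_sym x i b (e 0) = x + e i.
Proof.
by rewrite -[e 0]add0r cube_sym_flip cube_sym0 /dihedral mulr0 addr0.
Qed.

Lemma cube_sym_block x i b :
  val (square_block x i b) = cube_sym x i b @: val (square_block 0 0 false).
Proof.
rewrite /= cube_sym_square 1?eq_sym ?turn_neq // cube_sym0 dihedral_turn.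
by rewrite /dihedral mulr0 addr0 addbF.
Qed.

Lemma cube_symmetry_even x i b : p x = false -> symmetry p E false (cube_sym x i b).
Proof. by move=> <-; apply: cube_symmetry. Qed.

Lemma cube_flag_sym x i b : p x = false ->
  cube_flag x i b = lift p E false (cube_sym x i b) @: cube_flag 0 0 false.
Proof.
move=> px; rewrite (lift_corner _ _ _ (cube_sym_block x i b)).
  by rewrite add0r cube_sym0 cube_sym_unit.
exact: cube_symmetry_even.
Qed.

Lemma cube_regular : is_regular (@block_rank V p E).
Proof.
apply: (block_regular (cube_flag_in 0 0 false)) => _ /cube_flagP[x [i [b [px ->]]]].
by exists (cube_sym x i b); [exact: cube_symmetry_even | exact: cube_flag_sym].
Qed.

Lemma cube_self_dual : self_dual 3 (@block_rank V p E).
Proof.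
apply: (block_self_dual (g := cube_sym (e 0) 0 false)).
by rewrite -(parity_unit 0); apply: cube_symmetry.
Qed.

(** The affine maps that move the base flag in its vertex, edge and 2-face. *)
Definition refl0 := cube_sym (e 0 + e 1) 1 true.
Definition refl1 := cube_sym 0 0 true.
Definition refl2 := cube_sym 0 1 true.

Lemma refl0_symmetry : symmetry p E false refl0.
Proof. by apply: cube_symmetry_even; rewrite parity_flip parity_unit. Qed.

Lemma refl1_symmetry : symmetry p E false refl1.
Proof. exact: cube_symmetry_even parity0. Qed.

Lemma refl2_symmetry : symmetry p E false refl2.
Proof. exact: cube_symmetry_even parity0. Qed.

Definition rotation := cube_sym 0 1 false.

Lemma rotationXE k x j : (rotation ^+ k)%g x j = x (j - k%:R).
Proof.
elim: k j => [|k IHk] j; first by rewrite perm1 subr0.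
rewrite expgSr permM cube_symE ffunE add0r IHk /dihedral_inv mul1r.
by rewrite -addrA -opprD -mulrS.
Qed.

Lemma order_rotation : #[rotation]%g = m.+3.
Proof.
have rotX k : (rotation ^+ k == 1)%g = (m.+3 %| k)%N.
  have -> : (m.+3 %| k)%N = (k%:R == 0 :> I) by rewrite -val_eqE /= Zp_nat.
  apply/eqP/eqP => [r1|k0]; last first.
    by apply/permP => x; apply/ffunP => j; rewrite rotationXE k0 subr0 perm1.
  have := congr1 (fun h : {perm V} => h (e 0) k%:R) r1.
  by rewrite /= rotationXE subrr perm1 !ffunE eqxx => /esym/eqP.
by apply/eqP; rewrite eqn_dvd order_dvdn rotX dvdnn -rotX -order_dvdn dvdnn.
Qed.

Lemma refl12 : (refl1 * refl2)%g = rotation.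
Proof.
apply/permP => x; apply/ffunP => j.
rewrite permM !cube_symE !ffunE !add0r /dihedral_inv; congr (x _).
by rewrite expr1 expr0 mulN1r !mulN1r subr0 opprK mul1r.
Qed.

Lemma order_refl12 : #[refl1 * refl2]%g = m.+3.
Proof. by rewrite refl12 order_rotation. Qed.

(** Translation by e_0 exchanges the vertex and the 2-face of the base flag and
    fixes its edge, so it conjugates refl2 to refl0 and commutes with refl1. *)
Lemma order_refl01 : #[refl0 * refl1]%g = m.+3.
Proof.
pose t := cube_sym (e 0) 0 false.
have invE j : dihedral_inv 0 false j = j by rewrite /dihedral_inv expr0 mul1r subr0.
have -> : refl0 = (refl2 ^ t)%g.
  apply: (mulgI t); rewrite conjgE mulKVg; apply/permP => x; apply/ffunP => j.
  rewrite !permM !cube_symE !invE !ffunE add0r -addrA; congr (_ + _).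
  have -> : (dihedral_inv 1 true j == 0) = (j == 1).
    by rewrite /dihedral_inv expr1 mulN1r oppr_eq0 subr_eq0.
  by rewrite addrA; case: (j == 1); case: (x _).
have -> : refl1 = (refl1 ^ t)%g.
  apply: (mulgI t); rewrite conjgE mulKVg; apply/permP => x; apply/ffunP => j.
  rewrite !permM !cube_symE !invE !ffunE !add0r; congr (_ + _).
  by rewrite /dihedral_inv expr1 mulN1r subr0 oppr_eq0.
rewrite -conjMg orderJ -[RHS]order_refl12 -[RHS](orderJ _ refl1).
by rewrite conjgE mulgA mulKg.
Qed.

Lemma cube_schlafli_type : has_schlafli_type (@block_rank V p E) 3 [:: m.+3; m.+3].
Proof.
pose g k := nth refl2 [:: refl0; refl1] k.
exists (cube_flag 0 0 false), (fun k => lift p E false (g k)); split=> //.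
- exact: cube_flag_in.
- have base := square_block_corner 0 0 false.
  have blk0 x i b : square x i (turn i b) = square 0 0 (turn 0 false) ->
    cube_sym x i b @: val (square_block 0 0 false) = val (square_block 0 0 false).
    by rewrite -cube_sym_block.
  have t01 : turn 0 false = 1 by rewrite /turn expr0 add0r.
  have t10 : turn 1 true = 0 by rewrite -t01 (turnK 0 false).
  case=> [|[|[|]]] // _; rewrite /g /=.
  + have := generator_node refl0_symmetry base; rewrite /= parity0; apply.
    * apply: blk0; rewrite t10 squareC t01 -(@square_base 0) //.
      by rewrite (square_base (square_flip 0 0 1)) squareC add0r square_flip.
    * by rewrite add0r cube_sym_unit addvK.
    * rewrite cube_sym0; apply/eqP => /ffunP/(_ 0); by rewrite !ffunE.
  + apply: (generator_blk refl1_symmetry base (cube_sym_block 0 0 true)).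
    * exact: cube_sym0.
    * by rewrite add0r cube_sym_unit add0r.
    * by apply/eqP => /(congr1 val)/(square_dir_inj (turn_neq _ _))/turn_inj.
  + have := generator_node refl2_symmetry (is_cornerC base).
    rewrite -cornerC /= parity_flip parity0; apply.
    * by apply: blk0; rewrite t10 squareC t01.
    * exact: cube_sym0.
    * by rewrite add0r cube_sym_unit add0r (inj_eq unit_vec_inj).
- case=> [|[|[|]]] // _; rewrite /g /=.
    by rewrite -liftM ?order_lift ?order_refl01 //;
      do ?[exact: symmetryM refl0_symmetry refl1_symmetry
          |exact: refl0_symmetry|exact: refl1_symmetry].
  by rewrite -liftM ?order_lift ?order_refl12 //;
    do ?[exact: symmetryM refl1_symmetry refl2_symmetry
        |exact: refl1_symmetry|exact: refl2_symmetry].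
Qed.

End Cube.

Theorem theorem1p3 (n : nat) (hn : 3 <= n) :
  exists (disp : Order.disp_t) (P : finPOrderType disp) (rk : P -> int),
    [/\ is_polytope rk 3, is_regular rk, self_dual 3 rk,
        has_schlafli_type rk 3 [:: n; n] & #|flags P| = 2 ^ n * n].
Proof.
case: n hn => [|[|[|m]]] // _.
exists block_display, (block_poset (squares m) (@parity m) : finPOrderType _).
exists (@block_rank _ (@parity m) (squares m)); split.
- exact: cube_polytope.
- exact: cube_regular.
- exact: cube_self_dual.
- exact: cube_schlafli_type.
- exact: card_cube_flags.
Qed.
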